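(* Let $R$ and $S$ be commutative rings with identity, $f:R\to S$ a ring homomorphism (preserving identities), and $J$ a non-zero proper ideal of $S$. Consider the properties: (a) $Z(R)^2=0$; (b) for every $r\in \mathrm{Reg}(R)$ and every $j\in J\setminus\{0\}$, $jf(r)\neq 0$; (c) for every $r\in Z(R)\setminus\{0\}$ and every $j\in J\setminus\{0\}$, $jf(r)=0$; (d) $J^2=0$. Suppose that $\Gamma(R)\neq\emptyset$ (i.e. $Z(R)\setminus\{0\}\neq\emptyset$) and that $R\bowtie^f J$ has the condition $(\star)$. Then the following statements are equivalent: (1) $\Gamma(R\bowtie^f J)$ is complete; (2) properties (a), (b), (c) and (d) hold; (3) $Z(R\bowtie^f J)^2=0$. Moreover, the implications $(2)\Rightarrow(3)\Rightarrow(1)$ hold without assuming that $\Gamma(R)\neq\emptyset$ or that $R\bowtie^f J$ has the condition $(\star)$.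
   Context: The amalgamation of $R$ with $S$ along $J$ with respect to $f$ is the subring $R\bowtie^f J=\{(r,f(r)+j)\mid r\in R,\ j\in J\}$ of $R\times S$. For a commutative ring $A$, $Z(A)$ is the set of zero-divisors of $A$ (including $0$), and $\mathrm{Reg}(A)=A\setminus Z(A)$ is the set of regular elements; $Z(A)^2=0$ means $xy=0$ for all $x,y\in Z(A)$ (including $x=y$). The zero-divisor graph $\Gamma(A)$ is the undirected graph with vertex set $Z(A)\setminus\{0\}$ in which distinct vertices $x,y$ are adjacent if and only if $xy=0$; it is complete if any two distinct vertices are adjacent. Condition $(\star)$: let $Z_1=\{(r,f(r)+j)\mid r\in Z(R),\ j\in J\}$ and $Z_2=\{(r,f(r)+j)\mid r\in R,\ j\in J,\ j'(f(r)+j)=0 \text{ for some } j'\in J\setminus\{0\}\}$. One says $R\bowtie^f J$ has the condition $(\star)$ if $Z(R\bowtie^f J)=Z_1\cup Z_2$. *)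

(* Defs.v *)
From HB Require Import structures.
From mathcomp Require Import all_boot all_order all_algebra.
From mathcomp Require Import boolp classical_sets.

Set Implicit Arguments.
Unset Strict Implicit.
Unset Printing Implicit Defensive.

Import GRing.Theory.
Local Open Scope classical_set_scope.
Local Open Scope ring_scope.

(* Rings are nontrivial here, so 0 is a zero-divisor. *)
Definition zdiv (A : comNzRingType) : set A :=
  [set x | exists2 y : A, y <> 0 & x * y = 0].
Arguments zdiv : clear implicits.

Definition reg (A : comNzRingType) : set A := ~` zdiv A.
Arguments reg : clear implicits.

(* X^2 = 0, including the products x * x. *)
Definition sq_zero (A : comNzRingType) (X : set A) : Prop :=
  forall x y, X x -> X y -> x * y = 0.

Record graph (T : Type) := Graph {
  vertices : set T;
  adjacent : T -> T -> Prop;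
  adjacent_vertices : forall x y, adjacent x y -> vertices x /\ vertices y;
  adjacent_sym : forall x y, adjacent x y -> adjacent y x;
  adjacent_irrefl : forall x, ~ adjacent x x
}.

Definition complete (T : Type) (G : graph T) : Prop :=
  forall x y, vertices G x -> vertices G y -> x <> y -> adjacent G x y.

Section ZeroDivisorGraph.
Variable A : comNzRingType.

Definition zdg_vertices : set A := zdiv A `\ 0.

Definition zdg_adjacent (x y : A) : Prop :=
  [/\ zdg_vertices x, zdg_vertices y, x <> y & x * y = 0].

Lemma zdg_adjacent_vertices x y :
  zdg_adjacent x y -> zdg_vertices x /\ zdg_vertices y.
Proof. by case. Qed.

Lemma zdg_adjacent_sym x y : zdg_adjacent x y -> zdg_adjacent y x.
Proof. by case=> vx vy xy xy0; split=> //; [move/esym | rewrite mulrC]. Qed.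

Lemma zdg_adjacent_irrefl x : ~ zdg_adjacent x x.
Proof. by case. Qed.

Definition zero_divisor_graph : graph A :=
  Graph zdg_adjacent_vertices zdg_adjacent_sym zdg_adjacent_irrefl.
End ZeroDivisorGraph.
Arguments zero_divisor_graph : clear implicits.

(* An [idealr S] is a proper ideal of the commutative ring S. It is a boolean
   predicate, which is no restriction in the presence of [boolp]: any
   [J : set S] is the boolean predicate [fun x => `[< J x >]]. *)
Section Amalgamation.
Variables (R S : comNzRingType) (f : {rmorphism R -> S}) (J : idealr S).

Definition amalg_set : set (R * S) :=
  [set x | exists r : R, exists2 j : S, j \in J & x = (r, f r + j)].

Definition amalg_pred : {pred R * S} := fun x => `[< amalg_set x >].

Lemma amalg_predE x : (x \in amalg_pred) = (x.2 - f x.1 \in J).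
Proof.
apply/idP/idP => [/asboolP[r [j jJ ->]] | xJ] /=.
  by rewrite addrC addrA addNr add0r.
apply/asboolP; exists x.1, (x.2 - f x.1) => //.
by rewrite addrC subrK -surjective_pairing.
Qed.

Lemma amalg_subring_closed : subring_closed amalg_pred.
Proof.
split=> [|x y|x y]; rewrite !amalg_predE /=.
- by rewrite rmorph1 subrr rpred0.
- move=> xJ yJ; rewrite rmorphB opprB addrACA.
  have -> : x.2 + f y.1 + (- y.2 - f x.1) = (x.2 - f x.1) - (y.2 - f y.1).
    by rewrite opprB [- y.2 - _]addrC addrACA [f y.1 - _]addrC.
  by rewrite rpredB.
- move=> xJ yJ; rewrite rmorphM.
  have -> : x.2 * y.2 - f x.1 * f y.1 =
      x.2 * (y.2 - f y.1) + f y.1 * (x.2 - f x.1).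
    by rewrite !mulrBr [f y.1 * x.2]mulrC [f y.1 * f _]mulrC addrA subrK.
  by rewrite rpredD // idealMr.
Qed.

HB.instance Definition _ :=
  GRing.isSubringClosed.Build (R * S)%type amalg_pred amalg_subring_closed.

Record amalg := Amalg { amalg_val : R * S; _ : amalg_val \in amalg_pred }.

HB.instance Definition _ := [isSub for amalg_val].
HB.instance Definition _ := [Choice of amalg by <:].
HB.instance Definition _ := [SubChoice_isSubComNzRing of amalg by <:].

Definition amalg_Z1 : set (R * S) :=
  [set x | exists r : R, exists j : S,
     [/\ zdiv R r, j \in J & x = (r, f r + j)]].

Definition amalg_Z2 : set (R * S) :=
  [set x | exists r : R, exists j : S,
     [/\ j \in J, x = (r, f r + j) &
         exists j' : S, [/\ j' \in J, j' <> 0 & j' * (f r + j) = 0]]].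

Definition cond_star : Prop :=
  amalg_val @` zdiv amalg = amalg_Z1 `|` amalg_Z2.

Definition reg_faithful : Prop :=
  forall (r : R) (j : S), reg R r -> j \in J -> j <> 0 -> j * f r <> 0.

Definition zdiv_annihilates : Prop :=
  forall (r : R) (j : S),
    zdiv R r -> r <> 0 -> j \in J -> j <> 0 -> j * f r = 0.
End Amalgamation.

(* Main.v *)
Require Import Defs.
From HB Require Import structures.
From mathcomp Require Import all_boot all_order all_algebra.
From mathcomp Require Import boolp classical_sets.

(** Write an element of the amalgamation as [(r, f r + j)]; the product of two
    of them is [(r s, f (r s) + k f r + j f s + j k)].

    If (a)-(d) hold, every zero-divisor of the amalgamation has its first
    coordinate in [zdiv R] ([fst_zdiv_amalg]): a witness [(s, f s + k)] against
    a regular [r] has [s = 0], hence [k <> 0] and [k f r = 0] because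
    [J^2 = 0], against (b).  In the product of two zero-divisors, (a) kills the
    terms in [r s], (c) the mixed terms and (d) the term [j k].

    Conversely, completeness says that distinct zero-divisors multiply to [0].
    Condition (star) makes [(r, f r + j)] a zero-divisor for each [r] in
    [zdiv R] and [j] in [J], so there is enough room to avoid equal factors:
    (a) comes from [(x, f x)] and [(y, f y + j)], distinct even if [x = y] when
    [j <> 0]; (c) and (d) come from [(r, f r + i)] and [(0, j)], distinct
    because [r <> 0].  If (b) failed for a regular [r], then [(r, f r)] would be
    a zero-divisor, hence would annihilate [(r0, f r0)] for any nonzero
    zero-divisor [r0] of [R], and [r] would not be regular. *)

Set Implicit Arguments.
Unset Strict Implicit.
Unset Printing Implicit Defensive.

Import GRing.Theory.
Local Open Scope classical_set_scope.
Local Open Scope ring_scope.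

Lemma zdiv0 (A : comNzRingType) : zdiv A 0.
Proof. by exists 1; [apply/eqP; exact: oner_neq0 | rewrite mul0r]. Qed.

Lemma complete_zero_divisor_graph_mul0 (A : comNzRingType) (x y : A) :
  complete (zero_divisor_graph A) -> zdiv A x -> zdiv A y -> x <> y ->
  x * y = 0.
Proof.
move=> cA zx zy xy.
have [-> | /eqP x0] := eqVneq x 0; first by rewrite mul0r.
have [-> | /eqP y0] := eqVneq y 0; first by rewrite mulr0.
by have [] := cA x y (conj zx x0) (conj zy y0) xy.
Qed.

Lemma sq_zero_zdiv_complete (A : comNzRingType) :
  sq_zero (zdiv A) -> complete (zero_divisor_graph A).
Proof.
by move=> A0 x y vx vy xy; split=> //; apply: A0; [case: vx | case: vy].
Qed.

Section Amalgamation.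
Variables (R S : comNzRingType) (f : {rmorphism R -> S}) (J : idealr S).

Lemma amalg_elt_subproof (r : R) (j : S) :
  j \in J -> (r, f r + j) \in amalg_pred f J.
Proof. by move=> jJ; rewrite amalg_predE /= addrC addKr. Qed.

Definition amalg_elt (r : R) (j : S) (jJ : j \in J) : amalg f J :=
  Amalg (amalg_elt_subproof r jJ).

Lemma amalg_eltP (x : amalg f J) :
  exists r j, exists jJ : j \in J, x = amalg_elt r jJ.
Proof.
have xJ : (val x).2 - f (val x).1 \in J by rewrite -amalg_predE; exact: valP.
exists (val x).1, ((val x).2 - f (val x).1), xJ; apply: val_inj => /=.
by rewrite addrC subrK -surjective_pairing.
Qed.

Lemma amalg_elt_eq (r s : R) (j k : S) (jJ : j \in J) (kJ : k \in J) :
  amalg_elt r jJ = amalg_elt s kJ <-> r = s /\ j = k.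
Proof.
split=> [[-> /addrI ->] //|[rs jk]].
by apply: val_inj; rewrite /= rs jk.
Qed.

Lemma amalg_elt_eq0 (r : R) (j : S) (jJ : j \in J) :
  amalg_elt r jJ = 0 <-> r = 0 /\ j = 0.
Proof.
split=> [[-> ] |[r0 j0]]; first by rewrite rmorph0 add0r.
by apply: val_inj; rewrite /= r0 j0 rmorph0 add0r.
Qed.

Lemma amalg_elt_mul_eq0 (r s : R) (j k : S) (jJ : j \in J) (kJ : k \in J) :
  amalg_elt r jJ * amalg_elt s kJ = 0 <->
  r * s = 0 /\ (f r + j) * (f s + k) = 0.
Proof.
split=> [[]//|[rs0 jk0]].
by apply: val_inj; congr pair.
Qed.

(** The witness is [(0, j')], so this half of (star) always holds. *)
Lemma zdiv_amalg_elt_annihilated (r : R) (j j' : S) (jJ : j \in J) :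
  j' \in J -> j' <> 0 -> j' * (f r + j) = 0 -> zdiv (amalg f J) (amalg_elt r jJ).
Proof.
move=> j'J j'0 ann; exists (amalg_elt 0 j'J); first by case/amalg_elt_eq0.
by apply/amalg_elt_mul_eq0; rewrite mulr0 rmorph0 add0r mulrC.
Qed.

Lemma zdiv_amalg_elt_fst (r : R) (j : S) (jJ : j \in J) :
  cond_star f J -> zdiv R r -> zdiv (amalg f J) (amalg_elt r jJ).
Proof.
move=> star zr.
have : (amalg_Z1 f J `|` amalg_Z2 f J) (val (amalg_elt r jJ)).
  by left; exists r, j.
by rewrite -star => -[x zx /val_inj <-].
Qed.

Lemma mul_zdiv_annihilates (r : R) (j : S) :
  zdiv_annihilates f J -> zdiv R r -> j \in J -> j * f r = 0.
Proof.
move=> annJ zr jJ.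
have [-> | /eqP r0] := eqVneq r 0; first by rewrite rmorph0 mulr0.
have [-> | /eqP j0] := eqVneq j 0; first by rewrite mul0r.
exact: annJ.
Qed.

(** A witness [(s, f s + k)] against a regular [r] has [s = 0]; then
    [0 = k (f r + j) = k f r], which faithfulness of regular elements forbids. *)
Lemma fst_zdiv_amalg (r : R) (j : S) (jJ : j \in J) :
  reg_faithful f J -> sq_zero [set j : S | j \in J] ->
  zdiv (amalg f J) (amalg_elt r jJ) -> zdiv R r.
Proof.
move=> regJ J0 [y]; have [s [k [kJ ->]]] := amalg_eltP y.
move=> y0 /amalg_elt_mul_eq0[rs0 jk0].
apply: contrapT => regr.
have s0 : s = 0 by apply: contrapT => s0; apply: regr; exists s.
have k0 : k <> 0 by move=> k0; apply: y0; apply/amalg_elt_eq0.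
apply: (regJ r k regr kJ k0).
by move: jk0; rewrite s0 rmorph0 add0r mulrC mulrDr (J0 k j) // addr0.
Qed.

Lemma sq_zero_zdiv_amalg :
  sq_zero (zdiv R) -> reg_faithful f J -> zdiv_annihilates f J ->
  sq_zero [set j : S | j \in J] -> sq_zero (zdiv (amalg f J)).
Proof.
move=> R0 regJ annJ J0 x y.
have [r [j [jJ ->]]] := amalg_eltP x; have [s [k [kJ ->]]] := amalg_eltP y.
move=> /(fst_zdiv_amalg regJ J0) zr /(fst_zdiv_amalg regJ J0) zs.
apply/amalg_elt_mul_eq0; split; first exact: R0.
rewrite mulrDl !mulrDr -rmorphM (R0 r s) // rmorph0 (J0 j k) //.
by rewrite [f r * k]mulrC !mul_zdiv_annihilates // !addr0.
Qed.

Section Complete.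
Hypotheses (starJ : cond_star f J)
           (cJ : complete (zero_divisor_graph (amalg f J))).

(** Distinct zero-divisors: [(r, f r)] and [(0, j)]. *)
Lemma complete_zdiv_annihilates : zdiv_annihilates f J.
Proof.
move=> r j zr r0 jJ j0; have J0 : 0 \in J by exact: rpred0.
have /amalg_elt_mul_eq0[_] : amalg_elt r J0 * amalg_elt 0 jJ = 0.
  apply: complete_zero_divisor_graph_mul0 cJ _ _ _.
  - exact: zdiv_amalg_elt_fst.
  - by apply: zdiv_amalg_elt_fst starJ _; exact: zdiv0.
  - by case/amalg_elt_eq.
by rewrite rmorph0 add0r addr0 mulrC.
Qed.

(** The nonzero zero-divisor [r] separates [(r, f r + i)] from [(0, j)], which
    would coincide for [r = 0] and [i = j]; the extra term [j f r] vanishes. *)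
Lemma complete_sq_zero_ideal (r : R) :
  zdiv R r -> r <> 0 -> sq_zero [set j : S | j \in J].
Proof.
move=> zr r0 i j /= iJ jJ.
have /amalg_elt_mul_eq0[_] : amalg_elt r iJ * amalg_elt 0 jJ = 0.
  apply: complete_zero_divisor_graph_mul0 cJ _ _ _.
  - exact: zdiv_amalg_elt_fst.
  - by apply: zdiv_amalg_elt_fst starJ _; exact: zdiv0.
  - by case/amalg_elt_eq.
rewrite rmorph0 add0r mulrDl [f r * j]mulrC.
by rewrite (mul_zdiv_annihilates complete_zdiv_annihilates) ?add0r.
Qed.

(** The nonzero [j] makes room in the second coordinate: [(x, f x)] and
    [(y, f y + j)] are distinct even if [x = y], so squares are covered too. *)
Lemma complete_sq_zero_zdiv (j : S) :
  j \in J -> j <> 0 -> sq_zero (zdiv R).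
Proof.
move=> jJ j0 x y zx zy; have J0 : 0 \in J by exact: rpred0.
suff /amalg_elt_mul_eq0[] : amalg_elt x J0 * amalg_elt y jJ = 0 by [].
apply: complete_zero_divisor_graph_mul0 cJ _ _ _.
- exact: zdiv_amalg_elt_fst.
- exact: zdiv_amalg_elt_fst.
- by case/amalg_elt_eq=> _ /esym.
Qed.

(** If [j f r = 0] with [j <> 0], then [(r, f r)] is a zero-divisor, so it
    annihilates [(r0, f r0)]: the first coordinate says that [r] is not
    regular. *)
Lemma complete_reg_faithful (r0 : R) :
  zdiv R r0 -> r0 <> 0 -> reg_faithful f J.
Proof.
move=> zr0 r0n0 r j regr jJ j0 jr0; have J0 : 0 \in J by exact: rpred0.
have /amalg_elt_mul_eq0[rr0 _] : amalg_elt r J0 * amalg_elt r0 J0 = 0.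
  apply: complete_zero_divisor_graph_mul0 cJ _ _ _.
  - by apply: zdiv_amalg_elt_annihilated jJ j0 _; rewrite addr0.
  - exact: zdiv_amalg_elt_fst.
  - by case/amalg_elt_eq=> rE _; apply: regr; rewrite rE.
by apply: regr; exists r0.
Qed.

End Complete.
End Amalgamation.

Theorem theorem3p1 (R S : comNzRingType) (f : {rmorphism R -> S})
    (J : idealr S) (J_neq0 : exists2 j : S, j \in J & j <> 0) :
  let P1 := complete (zero_divisor_graph (amalg f J)) in
  let P2 := [/\ sq_zero (zdiv R), reg_faithful f J,
                zdiv_annihilates f J & sq_zero [set j : S | j \in J]] in
  let P3 := sq_zero (zdiv (amalg f J)) in
  [/\ (vertices (zero_divisor_graph R) !=set0 -> cond_star f J ->
         (P1 <-> P2) /\ (P2 <-> P3)),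
      (P2 -> P3)
    & (P3 -> P1)].
Proof.
move=> P1 P2 P3.
have P23 : P2 -> P3 by case; exact: sq_zero_zdiv_amalg.
have P31 : P3 -> P1 by exact: sq_zero_zdiv_complete.
split=> // -[r0 [zr0 r0n0]] star.
have P12 : P1 -> P2.
  move=> cJ; have [j jJ j0] := J_neq0; split.
  - exact: complete_sq_zero_zdiv star cJ _ jJ j0.
  - exact: complete_reg_faithful star cJ _ zr0 r0n0.
  - exact: complete_zdiv_annihilates.
  - exact: complete_sq_zero_ideal star cJ _ zr0 r0n0.
split; first by split=> [/P12|/P23/P31].
by split=> [/P23|/P31/P12].
Qed.
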